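(* Let $n\ge 2$ be an arbitrary positive integer, let $\Bbbk$ be a field containing a primitive $n$-th root of unity $\omega$, and let $H=H_{n^2}$ be the Taft Hopf algebra. The semisimple left coideal subalgebras of $H$ are of one of two types: (1) $\Bbbk G'\subset\Bbbk G\subset H$ for some subgroup $G'\subset G$; (2) $\mathcal{N}_\beta$, the algebra generated by $g+\beta x$, for some $\beta\in\Bbbk^\times$.
   Context: The Taft Hopf algebra $H_{n^2}$ is the algebra $\Bbbk[x]/(x^n)\rtimes\Bbbk[G]$, where $G=\mathbb{Z}/n\mathbb{Z}$ is generated by $g$ (so $g^n=1$, $x^n=0$) and $gxg^{-1}=\omega x$; its coalgebra structure is $\Delta(g)=g\otimes g$, $\Delta(x)=x\otimes 1+g\otimes x$. It is $n^2$-dimensional with basis $x^ig^j$, $0\le i,j\le n-1$. A left coideal subalgebra of a Hopf algebra $\mathcal{A}$ is a unital subalgebra $\mathcal{N}$ with $\Delta(\mathcal{N})\subset\mathcal{A}\otimes\mathcal{N}$. $\Bbbk^\times=\Bbbk\setminus\{0\}$. *)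

(* Defs.v *)
From HB Require Import structures.
From mathcomp Require Import all_boot all_order all_algebra all_fingroup.
From mathcomp Require Import all_field ring zify.

Set Implicit Arguments.
Unset Strict Implicit.
Unset Printing Implicit Defensive.

Import GRing.Theory.
Local Open Scope ring_scope.

(* A tensor of A (x) B is its matrix of coordinates in the bases vbasis {:A}  *)
(* and vbasis {:B}; by tens_mul, (a (x) b)(c (x) d) = ac (x) bd.             *)

Definition tensor (K : fieldType) (A B : falgType K) : Type :=
  'M[K]_(\dim {:A}, \dim {:B}).

HB.instance Definition _ (K : fieldType) (A B : falgType K) :=
  Vector.copy (tensor A B) 'M[K]_(\dim {:A}, \dim {:B}).

Section Tensor.

Variables (K : fieldType) (A B : falgType K).
Implicit Types (a c : A) (b d : B) (M N P : tensor A B).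

Definition tens a b : tensor A B :=
  \matrix_(i, j) (coord (vbasis {:A}) i a * coord (vbasis {:B}) j b).

Definition tensor_mul M N : tensor A B :=
  \sum_i \sum_j \sum_k \sum_l (M i j * N k l) *:
    tens ((vbasis {:A})`_i * (vbasis {:A})`_k)
         ((vbasis {:B})`_j * (vbasis {:B})`_l).

Lemma tensDl b : {morph tens^~ b : a c / a + c}.
Proof. by move=> a c; apply/matrixP=> i j; rewrite !mxE linearD mulrDl. Qed.

Lemma tensDr a : {morph tens a : b d / b + d}.
Proof. by move=> b d; apply/matrixP=> i j; rewrite !mxE linearD mulrDr. Qed.

Lemma tensZl k a b : tens (k *: a) b = k *: tens a b.
Proof. by apply/matrixP=> i j; rewrite !mxE linearZ /= mulrA. Qed.

Lemma tensZr k a b : tens a (k *: b) = k *: tens a b.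
Proof. by apply/matrixP=> i j; rewrite !mxE linearZ /= mulrCA. Qed.

Lemma tens0l b : tens 0 b = 0.
Proof. by apply/matrixP=> i j; rewrite !mxE linear0 mul0r. Qed.

Lemma tens0r a : tens a 0 = 0.
Proof. by apply/matrixP=> i j; rewrite !mxE linear0 mulr0. Qed.

Lemma tens_suml I r (Q : pred I) F b :
  tens (\sum_(i <- r | Q i) F i) b = \sum_(i <- r | Q i) tens (F i) b.
Proof. exact: (big_morph _ (tensDl b) (tens0l b)). Qed.

Lemma tens_sumr I r (Q : pred I) F a :
  tens a (\sum_(i <- r | Q i) F i) = \sum_(i <- r | Q i) tens a (F i).
Proof. exact: (big_morph _ (tensDr a) (tens0r a)). Qed.

Lemma tens_eq0 a b : (tens a b == 0) = (a == 0) || (b == 0).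
Proof.
apply/idP/idP=> [/eqP ab0 | /orP[] /eqP->]; rewrite ?tens0l ?tens0r //.
apply/orP.
have [a0|a_n0] := eqVneq a 0; [by left | right].
have /existsP[i ai] : [exists i, coord (vbasis {:A}) i a != 0].
  apply: contraNT a_n0 => /existsPn ha.
  rewrite (coord_vbasis (memvf a)) big1 // => i _.
  by move: (ha i); rewrite negbK => /eqP->; rewrite scale0r.
rewrite (coord_vbasis (memvf b)) big1 // => j _.
move/matrixP/(_ i j)/eqP: ab0; rewrite !mxE mulf_eq0 (negPf ai) /=.
by move/eqP->; rewrite scale0r.
Qed.

Lemma tensor_expand M :
  M = \sum_i \sum_j M i j *: tens (vbasis {:A})`_i (vbasis {:B})`_j.
Proof.
apply/matrixP=> i j; rewrite summxE (bigD1 i) //= summxE (bigD1 j) //=.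
have fA := basis_free (vbasisP {:A}); have fB := basis_free (vbasisP {:B}).
rewrite !mxE !coord_free // !eqxx mulr1 mulr1.
rewrite !big1 ?addr0 // => [i' ni|j' nj].
  rewrite summxE big1 // => j' _.
  by rewrite !mxE !coord_free // (negPf ni) mul0r mulr0.
by rewrite !mxE !coord_free // (negPf nj) !mulr0.
Qed.

Lemma tensor_ind (Q : tensor A B -> Prop) :
    (forall M N, Q M -> Q N -> Q (M + N)) -> (forall a b, Q (tens a b)) ->
  forall M, Q M.
Proof.
move=> QD Qt M; have Q0 : Q 0 by rewrite -(tens0l 0); apply: Qt.
rewrite [M]tensor_expand; do 2!apply: big_ind => // ? _.
by rewrite -tensZl; apply: Qt.
Qed.

Lemma tensor_mulDl : left_distributive tensor_mul +%R.
Proof.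
move=> M N P; rewrite /tensor_mul -big_split; apply: eq_bigr => i _ /=.
rewrite -big_split; apply: eq_bigr => j _ /=.
rewrite -big_split; apply: eq_bigr => k _ /=.
rewrite -big_split; apply: eq_bigr => l _ /=.
by rewrite !mxE mulrDl scalerDl.
Qed.

Lemma tensor_mulDr : right_distributive tensor_mul +%R.
Proof.
move=> M N P; rewrite /tensor_mul -big_split; apply: eq_bigr => i _ /=.
rewrite -big_split; apply: eq_bigr => j _ /=.
rewrite -big_split; apply: eq_bigr => k _ /=.
rewrite -big_split; apply: eq_bigr => l _ /=.
by rewrite !mxE mulrDr scalerDl.
Qed.

Lemma tensor_mulE a b c d :
  tensor_mul (tens a b) (tens c d) = tens (a * c) (b * d).
Proof.
rewrite {2}(coord_vbasis (memvf a)) {2}(coord_vbasis (memvf b)).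
rewrite {2}(coord_vbasis (memvf c)) {2}(coord_vbasis (memvf d)).
rewrite mulr_suml tens_suml; apply: eq_bigr => i _.
rewrite mulr_suml tens_sumr; apply: eq_bigr => j _.
rewrite mulr_sumr tens_suml; apply: eq_bigr => k _.
rewrite mulr_sumr tens_sumr; apply: eq_bigr => l _.
rewrite -!scalerAl -!scalerAr !tensZl !tensZr !scalerA !mxE.
by congr (_ *: _); ring.
Qed.

Lemma tensor_mulA : associative tensor_mul.
Proof.
elim/tensor_ind=> [M1 M2 h1 h2|a b] N P; first by rewrite !tensor_mulDl h1 h2.
elim/tensor_ind: N => [M1 M2 h1 h2|c d].
  by rewrite tensor_mulDr !tensor_mulDl tensor_mulDr h1 h2.
elim/tensor_ind: P => [M1 M2 h1 h2|e f]; first by rewrite !tensor_mulDr h1 h2.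
by rewrite !tensor_mulE !mulrA.
Qed.

Lemma tensor_mul1l : left_id (tens 1 1) tensor_mul.
Proof.
elim/tensor_ind=> [M1 M2 h1 h2|a b]; first by rewrite tensor_mulDr h1 h2.
by rewrite tensor_mulE !mul1r.
Qed.

Lemma tensor_mul1r : right_id (tens 1 1) tensor_mul.
Proof.
elim/tensor_ind=> [M1 M2 h1 h2|a b]; first by rewrite tensor_mulDl h1 h2.
by rewrite tensor_mulE !mulr1.
Qed.

Lemma tensor1_neq0 : tens 1 1 != 0.
Proof. by rewrite tens_eq0 !oner_eq0. Qed.

HB.instance Definition _ := GRing.Zmodule_isNzRing.Build (tensor A B)
  tensor_mulA tensor_mul1l tensor_mul1r tensor_mulDl tensor_mulDr tensor1_neq0.

Lemma tens_mul a b c d : tens a b * tens c d = tens (a * c) (b * d).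
Proof. exact: tensor_mulE. Qed.

Lemma tensor_scaleAl k M N : k *: (M * N) = (k *: M) * N.
Proof.
elim/tensor_ind: M => [M1 M2 h1 h2|a b].
  by rewrite scalerDr !mulrDl scalerDr h1 h2.
elim/tensor_ind: N => [M1 M2 h1 h2|c d]; first by rewrite !mulrDr scalerDr h1 h2.
by rewrite -tensZl !tens_mul -scalerAl tensZl.
Qed.

HB.instance Definition _ :=
  GRing.Lmodule_isLalgebra.Build K (tensor A B) tensor_scaleAl.

Lemma tensor_scaleAr k M N : k *: (M * N) = M * (k *: N).
Proof.
elim/tensor_ind: M => [M1 M2 h1 h2|a b]; first by rewrite !mulrDl scalerDr h1 h2.
elim/tensor_ind: N => [M1 M2 h1 h2|c d].
  by rewrite scalerDr !mulrDr scalerDr h1 h2.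
by rewrite -tensZl !tens_mul -scalerAr tensZl.
Qed.

HB.instance Definition _ :=
  GRing.Lalgebra_isAlgebra.Build K (tensor A B) tensor_scaleAr.
HB.instance Definition _ := Algebra_isFalgebra.Build K (tensor A B).

Definition tensor_vs (U : {vspace A}) (V : {vspace B}) : {vspace tensor A B} :=
  <<[seq tens u v | u <- vbasis U, v <- vbasis V]>>%VS.

End Tensor.

(* The entry (i, j) of the matrix is the coefficient of x^i g^j.  The product *)
(* is associative because w^n = 1, hence the dependency on w_prim.           *)

Definition taft (K : fieldType) (n : nat) (w : K)
  (w_prim : n.-primitive_root w) : Type := 'M[K]_n.

HB.instance Definition _ (K : fieldType) (n : nat) (w : K)
  (w_prim : n.-primitive_root w) := Vector.copy (taft w_prim) 'M[K]_n.

Section Taft.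

Variables (K : fieldType) (n : nat) (w : K) (w_prim : n.-primitive_root w).
Local Notation H := (taft w_prim).
Implicit Types (u v : H) (i j k l : nat).

(* x^i g^j for arbitrary i and j; it is 0 when n <= i. *)
Definition taft_mon i j : H :=
  \matrix_(a < n, b < n) ((a == i :> nat) && (b == j %[mod n]))%:R.

(* (x^i g^j)(x^k g^l) = w^(jk) x^(i+k) g^(j+l) since g x = w x g. *)
Definition taft_mul u v : H :=
  \sum_i \sum_j \sum_k \sum_l
    (u i j * v k l * w ^+ (j * k)) *: taft_mon (i + k) (j + l).

Lemma taft_mon_mod i j : taft_mon i (j %% n) = taft_mon i j.
Proof. by apply/matrixP=> a b; rewrite !mxE modn_mod. Qed.

Lemma taft_mon_eq0 i j : (n <= i)%N -> taft_mon i j = 0.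
Proof.
by move=> le_ni; apply/matrixP=> a b; rewrite !mxE ltn_eqF // (leq_trans _ le_ni).
Qed.

Lemma taft_mon_delta (i j : 'I_n) : taft_mon i j = delta_mx i j.
Proof.
by apply/matrixP=> a b; rewrite !mxE !modn_small.
Qed.

Lemma taft_expand u : u = \sum_(i < n) \sum_(j < n) u i j *: taft_mon i j.
Proof.
rewrite {1}(matrix_sum_delta u); apply: eq_bigr => i _; apply: eq_bigr => j _.
by rewrite taft_mon_delta.
Qed.

Lemma taft_ind (Q : H -> Prop) :
    (forall u v, Q u -> Q v -> Q (u + v)) ->
    (forall c i j, Q (c *: taft_mon i j)) ->
  forall u, Q u.
Proof.
move=> QD Qm u; have Q0 : Q 0 by rewrite -(scale0r (taft_mon 0 0)); apply: Qm.
by rewrite [u]taft_expand; do 2!apply: big_ind => // ? _.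
Qed.

Lemma taft_mulDl : left_distributive taft_mul +%R.
Proof.
move=> u1 u2 v; rewrite /taft_mul -big_split; apply: eq_bigr => i _ /=.
rewrite -big_split; apply: eq_bigr => j _ /=.
rewrite -big_split; apply: eq_bigr => k _ /=.
rewrite -big_split; apply: eq_bigr => l _ /=.
by rewrite !mxE !mulrDl scalerDl.
Qed.

Lemma taft_mulDr : right_distributive taft_mul +%R.
Proof.
move=> u v1 v2; rewrite /taft_mul -big_split; apply: eq_bigr => i _ /=.
rewrite -big_split; apply: eq_bigr => j _ /=.
rewrite -big_split; apply: eq_bigr => k _ /=.
rewrite -big_split; apply: eq_bigr => l _ /=.
by rewrite !mxE !(mulrDl, mulrDr) scalerDl.
Qed.

Lemma taft_mulZl c u v : taft_mul (c *: u) v = c *: taft_mul u v.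
Proof.
rewrite /taft_mul scaler_sumr; apply: eq_bigr => i _.
rewrite scaler_sumr; apply: eq_bigr => j _.
rewrite scaler_sumr; apply: eq_bigr => k _.
rewrite scaler_sumr; apply: eq_bigr => l _.
by rewrite !mxE scalerA !mulrA.
Qed.

Lemma taft_mulZr c u v : taft_mul u (c *: v) = c *: taft_mul u v.
Proof.
rewrite /taft_mul scaler_sumr; apply: eq_bigr => i _.
rewrite scaler_sumr; apply: eq_bigr => j _.
rewrite scaler_sumr; apply: eq_bigr => k _.
rewrite scaler_sumr; apply: eq_bigr => l _.
by rewrite !mxE scalerA !mulrA [c * _]mulrC.
Qed.

Lemma taft_mul0l v : taft_mul 0 v = 0.
Proof. by rewrite -(scale0r 0) taft_mulZl !scale0r. Qed.

Lemma taft_mul0r u : taft_mul u 0 = 0.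
Proof. by rewrite -(scale0r 0) taft_mulZr !scale0r. Qed.

Lemma taft_mul_mon i j k l :
  taft_mul (taft_mon i j) (taft_mon k l) =
  w ^+ (j * k) *: taft_mon (i + k) (j + l).
Proof.
have n_gt0 := prim_order_gt0 w_prim.
have [le_ni|lt_in] := leqP n i.
  rewrite (taft_mon_eq0 j le_ni) taft_mul0l taft_mon_eq0 ?scaler0 //.
  by rewrite (leq_trans le_ni) ?leq_addr.
have [le_nk|lt_kn] := leqP n k.
  rewrite (taft_mon_eq0 l le_nk) taft_mul0r taft_mon_eq0 ?scaler0 //.
  by rewrite (leq_trans le_nk) ?leq_addl.
rewrite -(taft_mon_mod i j) -(taft_mon_mod k l).
pose i' := Ordinal lt_in; pose k' := Ordinal lt_kn.
pose j' := Ordinal (ltn_pmod j n_gt0); pose l' := Ordinal (ltn_pmod l n_gt0).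
rewrite (taft_mon_delta i' j') (taft_mon_delta k' l') /taft_mul.
rewrite (bigD1 i') //= (bigD1 j') //= (bigD1 k') //= (bigD1 l') //=.
rewrite !mxE !eqxx mulr1 mul1r.
have d0 (a b a' b' : 'I_n) : (a, b) != (a', b') -> (delta_mx a b : H) a' b' = 0.
  by rewrite mxE xpair_eqE [a' == a]eq_sym [b' == b]eq_sym => /negPf->.
rewrite !big1 ?addr0 => [|i1 ni|j1 nj|k1 nk|l1 nl].
- rewrite -(taft_mon_mod (i + k) (j %% n + l %% n)) modnDm taft_mon_mod.
  congr (_ *: _); rewrite -(prim_expr_mod w_prim (_ * _)) modnMml.
  by rewrite prim_expr_mod.
- rewrite big1 // => j1 _; rewrite big1 // => k1 _; rewrite big1 // => l1 _.
  by rewrite d0 ?mul0r ?scale0r // xpair_eqE eq_sym (negPf ni).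
- rewrite big1 // => k1 _; rewrite big1 // => l1 _.
  by rewrite d0 ?mul0r ?scale0r // xpair_eqE andbC eq_sym (negPf nj).
- rewrite big1 // => l1 _.
  by rewrite d0 ?mul0r ?mulr0 ?mul0r ?scale0r // xpair_eqE eq_sym (negPf nk).
- by rewrite d0 ?mulr0 ?mul0r ?scale0r // xpair_eqE andbC eq_sym (negPf nl).
Qed.

Lemma taft_mulA : associative taft_mul.
Proof.
elim/taft_ind=> [u1 u2 h1 h2|c1 i j] v z; first by rewrite !taft_mulDl h1 h2.
elim/taft_ind: v => [v1 v2 h1 h2|c2 k l].
  by rewrite taft_mulDr !taft_mulDl taft_mulDr h1 h2.
elim/taft_ind: z => [z1 z2 h1 h2|c3 a b]; first by rewrite !taft_mulDr h1 h2.
rewrite !(taft_mulZl, taft_mulZr, taft_mul_mon) !scalerA !addnA.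
congr (_ *: _); rewrite mulnDl mulnDr !exprD.
by ring.
Qed.

Lemma taft_mul1l : left_id (taft_mon 0 0) taft_mul.
Proof.
elim/taft_ind=> [u1 u2 h1 h2|c i j]; first by rewrite taft_mulDr h1 h2.
by rewrite taft_mulZr taft_mul_mon mul0n expr0 scale1r.
Qed.

Lemma taft_mul1r : right_id (taft_mon 0 0) taft_mul.
Proof.
elim/taft_ind=> [u1 u2 h1 h2|c i j]; first by rewrite taft_mulDl h1 h2.
by rewrite taft_mulZl taft_mul_mon muln0 expr0 scale1r !addn0.
Qed.

Lemma taft1_neq0 : taft_mon 0 0 != 0.
Proof.
apply/eqP=> /matrixP/(_ (Ordinal (prim_order_gt0 w_prim))
                        (Ordinal (prim_order_gt0 w_prim)))/eqP.
by rewrite !mxE !eqxx oner_eq0.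
Qed.

HB.instance Definition _ := GRing.Zmodule_isNzRing.Build H
  taft_mulA taft_mul1l taft_mul1r taft_mulDl taft_mulDr taft1_neq0.

Lemma taft_scaleAl c u v : c *: (u * v) = (c *: u) * v.
Proof. exact/esym/taft_mulZl. Qed.

HB.instance Definition _ := GRing.Lmodule_isLalgebra.Build K H taft_scaleAl.

Lemma taft_scaleAr c u v : c *: (u * v) = u * (c *: v).
Proof. exact/esym/taft_mulZr. Qed.

HB.instance Definition _ := GRing.Lalgebra_isAlgebra.Build K H taft_scaleAr.
HB.instance Definition _ := Algebra_isFalgebra.Build K H.

Definition taft_x : H := taft_mon 1 0.
Definition taft_g : H := taft_mon 0 1.

Lemma taft_monE i j : taft_mon i j = taft_x ^+ i * taft_g ^+ j.
Proof.
have xE k : taft_x ^+ k = taft_mon k 0.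
  elim: k => // k IHk; rewrite exprS IHk.
  by apply: etrans (taft_mul_mon _ _ _ _) _; rewrite expr0 scale1r.
have gE k : taft_g ^+ k = taft_mon 0 k.
  elim: k => // k IHk; rewrite exprS IHk.
  by apply: etrans (taft_mul_mon _ _ _ _) _; rewrite muln0 expr0 scale1r.
rewrite xE gE; apply/esym/(etrans (taft_mul_mon _ _ _ _)).
by rewrite expr0 scale1r addn0.
Qed.

Lemma taft_gXn : taft_g ^+ n = 1.
Proof.
by rewrite -[LHS]mul1r -(expr0 taft_x) -taft_monE -taft_mon_mod modnn.
Qed.

Lemma taft_xXn : taft_x ^+ n = 0.
Proof. by rewrite -[LHS]mulr1 -(expr0 taft_g) -taft_monE taft_mon_eq0. Qed.

Lemma taft_gx : taft_g * taft_x = w *: (taft_x * taft_g).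
Proof. by apply: etrans (taft_mul_mon _ _ _ _) _; rewrite taft_monE !expr1. Qed.

(* The algebra morphism sending x to x (x) 1 + g (x) x and g to g (x) g: see  *)
(* taft_comul_x, taft_comul_g and taft_comul_is_monoid_morphism.             *)
Definition taft_comul u : tensor H H :=
  \sum_(i < n) \sum_(j < n) u i j *:
    ((tens taft_x 1 + tens taft_g taft_x) ^+ i * tens taft_g taft_g ^+ j).

End Taft.

(* The Gaussian binomial coefficients; they only serve to show below that    *)
(* taft_comul is multiplicative.                                             *)
Fixpoint qbin (K : fieldType) (q : K) (m k : nat) : K :=
  match m, k with
  | _, 0 => 1
  | 0, _.+1 => 0
  | m'.+1, k'.+1 => qbin q m' k' + q ^+ k * qbin q m' k
  end.

Section QBinomial.

Variables (K : fieldType) (q : K).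

Lemma qbin0 m : qbin q m 0 = 1. Proof. by case: m. Qed.

Lemma qbinS m k :
  qbin q m.+1 k.+1 = qbin q m k + q ^+ k.+1 * qbin q m k.+1.
Proof. by []. Qed.

Lemma qbin_small m k : (m < k)%N -> qbin q m k = 0.
Proof.
elim: m k => [|m IHm] [|k] // lt_mk.
by rewrite qbinS !IHm ?mulr0 ?addr0 // ltnW.
Qed.

Lemma qbin_succ m k :
  (1 - q ^+ k.+1) * qbin q m k.+1 = (1 - q ^+ (m - k)) * qbin q m k.
Proof.
have [le_mk|] := leqP m k.
  by rewrite (qbin_small (leq_ltn_trans le_mk _)) // (eqP le_mk) subrr mul0r mulr0.
elim: m k => // m IHm [|k] lt_km.
  have [m0|m_gt0] := posnP m; first by rewrite m0 /=; ring.
  have := IHm 0%N m_gt0; rewrite qbinS !qbin0 !subn0 expr1 !mulr1 => IH.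
  by rewrite mulrDr mulrCA IH exprS; ring.
rewrite subSS; have := IHm k lt_km; have [lt_km1|le_mk] := ltnP k.+1 m.
  have := IHm _ lt_km1; have -> : (m - k = (m - k.+1).+1)%N by lia.
  rewrite (qbinS m k) (qbinS m k.+1); set c0 := qbin q m k.
  set c1 := qbin q m k.+1; set c2 := qbin q m k.+2 => IH1 IH0.
  rewrite [LHS]mulrDr [X in _ + X]mulrCA IH1 [RHS]mulrDr -IH0.
  by rewrite !exprS; ring.
rewrite (qbinS m k) (qbinS m k.+1) (@qbin_small m k.+2) //.
have -> : (m - k = 1)%N by lia.
set c0 := qbin q m k; set c1 := qbin q m k.+1 => IH0.
by rewrite [RHS]mulrDr -IH0 !exprS; ring.
Qed.

Lemma qbin_prim m k :
  m.-primitive_root q -> (0 < k < m)%N -> qbin q m k = 0.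
Proof.
move=> q_prim; elim: k => // k IHk /= lt_km.
have /mulfI : 1 - q ^+ k.+1 != 0.
  by rewrite subr_eq0 eq_sym -(prim_order_dvd q_prim) gtnNdvd.
apply; rewrite mulr0 qbin_succ; case: k => [|k] in IHk lt_km *.
  by rewrite subn0 (prim_expr_order q_prim) subrr mul0r.
by rewrite IHk ?mulr0 //= ltnW.
Qed.

Lemma qexprD (A : algType K) (a b : A) m : b * a = q *: (a * b) ->
  (a + b) ^+ m = \sum_(k < m.+1) qbin q m k *: (a ^+ k * b ^+ (m - k)).
Proof.
move=> ba; have baX k : b * a ^+ k = q ^+ k *: (a ^+ k * b).
  elim: k => [|k IHk]; first by rewrite !expr0 mul1r mulr1 scale1r.
  rewrite [in LHS]exprS [LHS]mulrA ba -[LHS]scalerAl -[X in _ *: X]mulrA IHk.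
  by rewrite -scalerAr scalerA !exprS mulrA.
elim: m => [|m IHm]; first by rewrite big_ord1 expr0 mul1r scale1r.
rewrite big_ord_recl qbin0 scale1r expr0 mul1r subn0.
rewrite [X in _ = _ + X](eq_bigr (fun k : 'I_m.+1 =>
    qbin q m k *: (a ^+ k.+1 * b ^+ (m - k)) +
    q ^+ k.+1 * qbin q m k.+1 *: (a ^+ k.+1 * b ^+ (m - k)))); last first.
  by move=> k _; rewrite lift0 qbinS subSS scalerDl.
rewrite exprS mulrDl IHm big_split /= addrCA; congr (_ + _).
  rewrite mulr_sumr; apply: eq_bigr => k _.
  by rewrite -scalerAr mulrA -exprS.
rewrite [in RHS]big_ord_recr /= qbin_small // mulr0 scale0r addr0.
rewrite big_ord_recl mulrDr qbin0 scale1r expr0 mul1r subn0 -exprS.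
congr (_ + _); rewrite mulr_sumr; apply: eq_bigr => k _; rewrite lift0.
rewrite -scalerAr mulrA baX -scalerAl scalerA [_ * q ^+ _]mulrC -mulrA -exprS.
by rewrite subnSK.
Qed.

End QBinomial.

Section TaftComul.

Variables (K : fieldType) (n : nat) (w : K) (w_prim : n.-primitive_root w).
Local Notation H := (taft w_prim).
Local Notation x := (taft_x w_prim).
Local Notation g := (taft_g w_prim).

Lemma taft_comul_is_linear : linear (@taft_comul K n w w_prim).
Proof.
move=> c u v; rewrite /taft_comul scaler_sumr -big_split; apply: eq_bigr => i _.
rewrite scaler_sumr -big_split; apply: eq_bigr => j _ /=.
by rewrite !mxE scalerA -scalerDl.
Qed.

HB.instance Definition _ := GRing.isLinear.Build K H (tensor H H) _
  (@taft_comul K n w w_prim) taft_comul_is_linear.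

Let X : tensor H H := tens x 1 + tens g x.
Let T : tensor H H := tens g g.

Let tensX (a b : H) k : tens a b ^+ k = tens (a ^+ k) (b ^+ k).
Proof. by elim: k => // k IHk; rewrite !exprS IHk tens_mul. Qed.

Let TXn : T ^+ n = 1. Proof. by rewrite tensX taft_gXn. Qed.

Let XXn : X ^+ n = 0.
Proof.
rewrite /X (qexprD (q := w)); last first.
  by rewrite !tens_mul taft_gx tensZl mulr1 mul1r.
rewrite big1 // => k _; rewrite !tensX.
have := ltn_ord k; rewrite ltnS leq_eqVlt => /orP[/eqP->|lt_kn].
  by rewrite taft_xXn tens0l mul0r scaler0.
have [k0|k_gt0] := posnP k.
  by rewrite k0 subn0 taft_xXn tens0r mulr0 scaler0.
by rewrite (qbin_prim w_prim) ?scale0r // k_gt0.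
Qed.

Let TX : T * X = w *: (X * T).
Proof.
rewrite /T /X mulrDr mulrDl !tens_mul taft_gx mul1r mulr1.
by rewrite scalerDr tensZl tensZr.
Qed.

Let TXX j k : T ^+ j * X ^+ k = w ^+ (j * k) *: (X ^+ k * T ^+ j).
Proof.
have T1 m : T * X ^+ m = w ^+ m *: (X ^+ m * T).
  elim: m => [|m IHm]; first by rewrite !expr0 mul1r mulr1 scale1r.
  rewrite [in LHS]exprS [LHS]mulrA TX -[LHS]scalerAl -[X in _ *: X]mulrA IHm.
  by rewrite -scalerAr scalerA !exprS mulrA.
elim: j => [|j IHj]; first by rewrite mul0n !expr0 mul1r mulr1 scale1r.
rewrite [in LHS]exprS -[LHS]mulrA IHj -scalerAr [X in _ *: X]mulrA T1.
by rewrite -scalerAl scalerA -mulrA -exprD -exprS mulSn addnC.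
Qed.

Lemma taft_comul_mon i j :
  taft_comul (taft_mon w_prim i j) = X ^+ i * T ^+ j.
Proof.
have [le_ni|lt_in] := leqP n i.
  by rewrite taft_mon_eq0 // linear0 -(subnK le_ni) exprD XXn mulr0 mul0r.
rewrite -taft_mon_mod -(expr_mod _ TXn).
pose j' := Ordinal (ltn_pmod j (prim_order_gt0 w_prim)).
rewrite (taft_mon_delta w_prim (Ordinal lt_in) j') /taft_comul.
rewrite (bigD1 (Ordinal lt_in)) //= (bigD1 j') //= mxE !eqxx scale1r.
rewrite !big1 ?addr0 // => [i1 ni|j1 nj].
  by rewrite big1 // => j1 _; rewrite mxE (negPf ni) scale0r.
by rewrite mxE (negPf nj) andbF scale0r.
Qed.

Lemma taft_comul_x : taft_comul x = tens x 1 + tens g x.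
Proof. by rewrite taft_comul_mon expr1 mulr1. Qed.

Lemma taft_comul_g : taft_comul g = tens g g.
Proof. by rewrite taft_comul_mon expr1 mul1r. Qed.

Lemma taft_comul_is_monoid_morphism : monoid_morphism (@taft_comul K n w w_prim).
Proof.
split; first by rewrite [LHS]taft_comul_mon mulr1.
elim/taft_ind=> [u1 u2 h1 h2|c i j] v.
  by rewrite mulrDl !linearD /= mulrDl h1 h2.
elim/taft_ind: v => [v1 v2 h1 h2|d k l].
  by rewrite mulrDr !linearD /= mulrDr h1 h2.
have -> : (c *: taft_mon w_prim i j) * (d *: taft_mon w_prim k l) =
    (c * d * w ^+ (j * k)) *: taft_mon w_prim (i + k) (j + l).
  rewrite -scalerAl -scalerAr !scalerA -[in RHS]scalerA; congr (_ *: _).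
  exact: taft_mul_mon.
rewrite !linearZ /= !taft_comul_mon -scalerAl -scalerAr !scalerA -[in LHS]scalerA.
congr (_ *: _); rewrite -mulrA (mulrA (T ^+ j)) TXX -scalerAl -scalerAr.
by rewrite !exprD !mulrA.
Qed.

HB.instance Definition _ := GRing.isMonoidMorphism.Build H (tensor H H)
  (@taft_comul K n w w_prim) taft_comul_is_monoid_morphism.

End TaftComul.


Section Semisimple.

Variables (K : fieldType) (A : falgType K).
Implicit Types N I J : {vspace A}.

(* Contrary to {aspace A}, the unit of N is required to be that of A. *)
Definition unital_subalgebra N : Prop := 1 \in N /\ (N * N <= N)%VS.

Definition left_ideal N I : Prop := (I <= N)%VS /\ (N * I <= I)%VS.

Definition simple_left_ideal N I : Prop :=
  [/\ left_ideal N I, I != 0%VS &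
      forall J, left_ideal N J -> (J <= I)%VS -> J = 0%VS \/ J = I].

(* For a unital subalgebra N: as a left module over itself, N is a direct    *)
(* sum of simple submodules.                                                 *)
Definition semisimple_subalgebra N : Prop :=
  exists (m : nat) (I : 'I_m -> {vspace A}),
    [/\ forall k, simple_left_ideal N (I k), directv (\sum_k I k) &
        N = (\sum_k I k)%VS].

End Semisimple.

Section TaftSubalgebras.

Variables (K : fieldType) (n : nat) (w : K) (w_prim : n.-primitive_root w).
Local Notation H := (taft w_prim).

Definition left_coideal_subalgebra (N : {vspace H}) : Prop :=
  unital_subalgebra N /\
  forall u, u \in N -> taft_comul u \in tensor_vs {:H} N.

(* The group algebra of G' in k<g>, with j : 'Z_n standing for g^j.  For     *)
(* n < 2 the type 'Z_n is not Z/nZ, but Z/2Z.                                *)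
Definition group_subalgebra (G' : {group 'Z_n}) : {vspace H} :=
  <<[seq (taft_g w_prim ^+ j)%R | j : 'Z_n <- enum G']>>%VS.

Definition beta_subalgebra (beta : K) : {vspace H} :=
  <<1; (taft_g w_prim + beta *: taft_x w_prim)%R>>%VS.

End TaftSubalgebras.

(* Main.v *)
From HB Require Import structures.
Require Import Defs.
From mathcomp Require Import all_boot all_order all_algebra all_fingroup.
From mathcomp Require Import all_solvable all_field.

Import GRing.Theory.
Local Open Scope ring_scope.

(** Write H for the Taft algebra and let N be a semisimple left coideal
    subalgebra.

    Applying functionals f (x) id to the comultiplication of elements of N
    gives elements of N (mem_tensor_vsP).  If every element of N has degree 0
    in x, this shows that N is spanned by the powers of g that it contains, and
    it is a group algebra (coideal_subalgebra_in_kG).  Otherwise take an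
    element of N with a top term x^a g^b, a > 0.  Slicing it at degree a yields
    g^b in N (top_coef_grouplike), and slicing it at degree a - 1 yields a
    combination of x g^b and g^(b+1) in which x g^b has a nonzero coefficient;
    dividing by g^b, some x + c g lies in N (top_coef_skew_primitive).

    The ideal xH is two-sided and nilpotent, and a semisimple algebra has no
    nonzero nilpotent ideal, so N meets xH only in 0 (semisimple_cap_xideal).
    This excludes c = 0.  For c nonzero, N contains t = g + beta x with
    beta = 1 / c.  As H / xH is spanned by the images g^k of the powers t^k,
    every element of N is a combination of powers of t modulo N meet xH = 0
    (semisimple_with_beta_gen).

    Conversely both kinds of subalgebras are generated by one element t with
    t^m = 1 and independent powers t^k, k < m, for some m dividing n: t = g^a
    since subgroups of Z/n are cyclic, or t = g + beta x, where t^n = 1 by the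
    q-binomial formula (beta_gen_order).  As K has a primitive m-th root of
    unity, such an algebra is a product of copies of K (semisimple_cyclic). The
    coideal condition needs to be checked on t only (left_coideal_adjoin1). *)

(** * Slices of tensors *)

Section TensorSlices.
Set Implicit Arguments.
Unset Strict Implicit.

Variables (K : fieldType) (A B : falgType K).
Implicit Types (f : {scalar A}) (M : tensor A B) (V W : {vspace B}).

(** The map f (x) id from A (x) B to B.  It turns the coideal condition
    into closure properties of the subspace itself. *)
Definition slice f M : B :=
  \sum_(i < \dim {:A}) \sum_(j < \dim {:B})
    (f (vbasis {:A})`_i * M i j) *: (vbasis {:B})`_j.

Lemma slice_is_linear f : linear (slice f).
Proof.
move=> c M M'; rewrite /slice scaler_sumr -big_split; apply: eq_bigr => i _ /=.
rewrite scaler_sumr -big_split; apply: eq_bigr => j _ /=.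
by rewrite !mxE mulrDr mulrCA scalerDl scalerA.
Qed.

HB.instance Definition _ f :=
  GRing.isLinear.Build K (tensor A B) B _ (slice f) (slice_is_linear f).

Lemma slice_tens f a b : slice f (tens a b) = f a *: b.
Proof.
rewrite {2}(coord_vbasis (memvf a)) linear_sum scaler_suml.
apply: eq_bigr => i _; rewrite {2}(coord_vbasis (memvf b)) scaler_sumr.
apply: eq_bigr => j _; rewrite mxE [f (_ *: _)]linearZ /= scalerA.
by rewrite mulrCA mulrA.
Qed.

Lemma tensor_slices M :
  M = \sum_(i < \dim {:A}) tens (vbasis {:A})`_i (slice (coord (vbasis {:A}) i) M).
Proof.
rewrite {1}[M]tensor_expand; apply: eq_bigr => i _.
rewrite /slice (bigD1 i) //= [X in tens _ (_ + X)]big1 => [|k nk].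
  rewrite addr0 tens_sumr; apply: eq_bigr => j _.
  by rewrite tensZr coord_free ?(basis_free (vbasisP _)) // eqxx mul1r.
rewrite big1 // => j _; rewrite coord_free ?(basis_free (vbasisP _)) //.
by rewrite (negPf nk) mul0r scale0r.
Qed.

Lemma tens_mem V a b : b \in V -> tens a b \in tensor_vs {:A} V.
Proof.
move=> Vb; rewrite (coord_vbasis (memvf a)) (coord_vbasis Vb) tens_suml.
apply: memv_suml => i _; rewrite tens_sumr; apply: memv_suml => j _.
rewrite tensZl tensZr !memvZ // memv_span //.
by apply: allpairs_f; rewrite mem_nth ?size_tuple.
Qed.

(** A (x) V is cut out by the functionals on the first factor: one
    direction because f (x) id maps A (x) V to V, the other because the slices
    along the coordinate functionals rebuild the tensor. *)
Lemma mem_tensor_vsP V M :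
  reflect (forall f, slice f M \in V) (M \in tensor_vs {:A} V).
Proof.
apply: (iffP idP) => [MV f | MV]; last first.
  by rewrite [M]tensor_slices memv_suml // => i _; apply: tens_mem.
have /subvP/(_ M MV) : (tensor_vs {:A} V <= linfun (slice f) @^-1: V)%VS.
  apply/span_subvP=> _ /allpairsP[[u v] [/= _ /vbasis_mem Vv ->]].
  by rewrite -memv_preim lfunE /= slice_tens memvZ.
by rewrite -memv_preim lfunE.
Qed.

Lemma tensX a b k : (tens a b : tensor A B) ^+ k = tens (a ^+ k) (b ^+ k).
Proof. by elim: k => // k IHk; rewrite !exprS IHk tens_mul. Qed.

End TensorSlices.

Lemma tensor_vsM (K : fieldType) (A B : falgType K) (V : {vspace B})
    (M M' : tensor A B) :
    (V * V <= V)%VS -> M \in tensor_vs {:A} V -> M' \in tensor_vs {:A} V ->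
  M * M' \in tensor_vs {:A} V.
Proof.
move=> VV /mem_tensor_vsP MV /mem_tensor_vsP MV'.
rewrite [M]tensor_slices [M']tensor_slices mulr_suml memv_suml // => i _.
rewrite mulr_sumr memv_suml // => k _; rewrite tens_mul tens_mem //.
exact/(subvP VV)/memv_mul.
Qed.

(** * Semisimple subalgebras *)

Section Semisimplicity.
Set Implicit Arguments.
Unset Strict Implicit.

Variables (K : fieldType) (A : falgType K).
Implicit Types (N I J : {vspace A}).

(** The last hypothesis is the form in which nilpotency of J is used.  On a
    simple left ideal I, the product J I is either 0 or I, and the second case
    is excluded by it; so J kills every simple summand of N, hence the unit. *)
Lemma semisimple_no_nilpotent_ideal N J :
    unital_subalgebra N -> semisimple_subalgebra N ->
    (N * J <= J)%VS -> (J <= N)%VS ->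
    (forall I, (I <= J * I)%VS -> I = 0%VS) -> J = 0%VS.
Proof.
move=> [N1 NN] [m [I [simpleI _ defN]]] NJ JN nilJ; apply/eqP; rewrite -subv0.
apply/subvP=> u Ju; move: N1; rewrite -[u]mulr1 defN => /memv_sumP[v Iv ->].
rewrite mulr_sumr memv_suml // => k _.
have [[IN NI] I0 minI] := simpleI k.
have JI_I : (J * I k <= I k)%VS by apply: subv_trans NI; apply: prodvSl.
have [| //| JI0 | JI] := minI (J * I k)%VS.
- by split; [apply: subv_trans IN | rewrite prodvA prodvSl].
- by rewrite -JI0 memv_mul ?Iv.
- by rewrite (nilJ (I k)) ?eqxx ?JI in I0.
Qed.

(** The lines spanned by the idempotents are the simple left ideals. *)
Lemma semisimple_idempotents N m (e : 'I_m -> A) :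
    (forall k, e k != 0) -> (forall k l, e k * e l = (k == l)%:R *: e l) ->
  N = (\sum_k <[e k]>)%VS -> semisimple_subalgebra N.
Proof.
move=> e0 ee defN; exists m, (fun k => <[e k]>%VS); split=> // [k|].
- split=> [|| J _ sJ]; last first.
  + have [|J0] := eqVneq J 0%VS; [by left | right].
    apply/eqP; rewrite eqEdim sJ dim_vline e0 lt0n dimv_eq0.
    by rewrite J0.
  + by rewrite -dimv_eq0 dim_vline e0.
  + split; first by rewrite defN (sumv_sup k).
    apply/prodvP=> u1 u2; rewrite defN => /memv_sumP[v ve ->] /vlineP[c ->].
    rewrite mulr_suml memv_suml // => l _.
    have /vlineP[d ->] := ve l isT.
    by rewrite -scalerAl -scalerAr ee !memvZ // memv_line.
- apply/directv_sum_independent=> v ve v0 k _.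
  have /vlineP[c vk] := ve k isT.
  move/(congr1 (fun u => u * e k)): v0; rewrite mul0r mulr_suml (bigD1 k) //=.
  rewrite big1 ?addr0 => [|l nlk].
    by rewrite vk -scalerAl ee eqxx scale1r.
  have /vlineP[d ->] := ve l isT.
  by rewrite -scalerAl ee (negPf nlk) scale0r scaler0.
Qed.

Lemma sum_powers_unity_root m (z : K) :
  z ^+ m = 1 -> \sum_(j < m) z ^+ j = if z == 1 then m%:R else 0.
Proof.
move=> zm; have [->|z1] := eqVneq.
  by rewrite (eq_bigr (fun=> 1)) => [|j _]; rewrite ?expr1n // sumr_const card_ord.
have /mulfI : z - 1 != 0 by rewrite subr_eq0.
by apply; rewrite -subrX1 zm subrr mulr0.
Qed.

Lemma adjoin1_cyclic m (t : A) : (0 < m)%N -> t ^+ m = 1 ->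
  <<1; t>>%VS = (\sum_(j < m) <[(t ^+ j)%R]>)%VS.
Proof.
move=> m0 tm; apply/eqP; rewrite eqEsubv; apply/andP; split; last first.
  apply/subv_sumP=> j _; rewrite -memvE.
  elim: (j : nat) => [|i IHi]; first by rewrite expr0 memvE sub1_agenv.
  by rewrite exprS -agenvM memv_mul // memv_adjoin.
have tj i : t ^+ i \in (\sum_(j < m) <[(t ^+ j)%R]>)%VS.
  rewrite -(expr_mod i tm) memvE.
  by rewrite (sumv_sup (Ordinal (ltn_pmod i m0))).
apply: agenv_sub_modl; first by rewrite -memvE -(expr0 t).
rewrite prodvDl prod1v subv_add subvv.
apply/prodvP=> _ _ /vlineP[c ->] /memv_sumP[v vt ->].
rewrite mulr_sumr memv_suml // => j _; have /vlineP[d ->] := vt j isT.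
by rewrite -scalerAl -scalerAr !memvZ // -exprS.
Qed.

(** Since K has the m-th roots of unity, K[t]/(t^m - 1) is a product of m
    copies of K; its idempotents come from the discrete Fourier transform on
    the powers of t. *)
Lemma semisimple_cyclic m (z : K) (t : A) :
    m.-primitive_root z -> t ^+ m = 1 ->
    (forall c : 'I_m -> K, \sum_j c j *: t ^+ j = 0 -> forall j, c j = 0) ->
  semisimple_subalgebra <<1; t>>%VS.
Proof.
move=> z_prim tm free_t; have m0 := prim_order_gt0 z_prim.
have mK := prim_root_natf_neq0 z_prim.
have z0 j : z ^+ j != 0.
  rewrite expf_neq0 //; apply/eqP=> z0.
  move/eqP: (prim_expr_order z_prim).
  by rewrite z0 expr0n gtn_eqF // eq_sym oner_eq0.
have delta (k l : 'I_m) : \sum_(j < m) (z ^+ k / z ^+ l) ^+ j = m%:R *+ (k == l).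
  rewrite sum_powers_unity_root; last first.
    by rewrite expr_div_n !(exprAC _ _ m) (prim_expr_order z_prim) !expr1n divr1.
  rewrite (can2_eq (divfK (z0 l)) (mulfK (z0 l))) mul1r.
  rewrite (eq_prim_root_expr z_prim) !modn_small // -val_eqE.
  by case: eqP.
pose e (k : 'I_m) : A := m%:R^-1 *: \sum_(j < m) (z ^+ k)^-1 ^+ j *: t ^+ j.
have te (k : 'I_m) j : t ^+ j * e k = (z ^+ k) ^+ j *: e k.
  elim: j => [|j IHj]; first by rewrite mul1r scale1r.
  suff tek : t * e k = z ^+ k *: e k.
    by rewrite exprSr -mulrA tek -scalerAr IHj scalerA -exprS.
  (* Multiplication by t shifts the Fourier sum cyclically. *)
  pose F j1 : A := (z ^+ k)^-1 ^+ j1 *: t ^+ j1.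
  have shift : \sum_(j1 < m) F j1.+1 = \sum_(j1 < m) F j1.
    apply: (addrI (F 0)); transitivity (\sum_(j1 < m.+1) F j1).
      by rewrite big_ord_recl.
    rewrite big_ord_recr addrC; congr (_ + _); rewrite /= /F tm exprVn exprAC.
    by rewrite (prim_expr_order z_prim) !expr1n invr1 expr0.
  rewrite -scalerAr scalerA mulrC -scalerA; congr (_ *: _).
  rewrite -[X in _ *: X]shift mulr_sumr scaler_sumr; apply: eq_bigr => j1 _.
  by rewrite -scalerAr scalerA !exprS mulrA mulfV ?mul1r.
apply: (@semisimple_idempotents _ m e) => [k | k l |].
- apply/eqP=> /eqP; rewrite scaler_eq0 invr_eq0 (negPf mK) => /eqP/free_t.
  by move/(_ (Ordinal m0))/eqP; rewrite expr0 oner_eq0.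
- rewrite {1}/e -scalerAl mulr_suml.
  rewrite (eq_bigr (fun j : 'I_m => (z ^+ l / z ^+ k) ^+ j *: e l)); last first.
    by move=> j _; rewrite -scalerAl te scalerA mulrC exprMn.
  rewrite -scaler_suml delta scalerA mulrnAr mulVf //.
  by rewrite eq_sym.
- rewrite (adjoin1_cyclic m0 tm); apply/eqP; rewrite eqEsubv.
  apply/andP; split; apply/subv_sumP=> j _; rewrite -memvE.
    have -> : t ^+ j = \sum_(k < m) (z ^+ k) ^+ j *: e k.
      rewrite /e (eq_bigr (fun k : 'I_m => \sum_(i < m)
         (m%:R^-1 * (z ^+ j / z ^+ i) ^+ k) *: t ^+ i)); last first.
        move=> k _; rewrite scalerA scaler_sumr; apply: eq_bigr => i _.
        rewrite scalerA mulrAC [m%:R^-1 * _]mulrC; congr (_ * _ *: _).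
        by rewrite exprMn !exprVn ![(z ^+ _) ^+ k]exprAC.
      rewrite exchange_big (bigD1 j) //= [X in _ + X]big1 => [|i nij].
        by rewrite -scaler_suml -mulr_sumr delta eqxx mulVf // scale1r addr0.
      by rewrite -scaler_suml -mulr_sumr delta eq_sym (negPf nij) mulr0 scale0r.
    rewrite memv_suml // => k _; rewrite memvZ // memvE.
    exact: (sumv_sup k).
  rewrite memvZ // memv_suml // => i _; rewrite memvZ // memvE.
  exact: (sumv_sup i).
Qed.

End Semisimplicity.

(** * Slices of the comultiplication *)

Section TaftCoideals.
Set Implicit Arguments.
Unset Strict Implicit.

Variables (K : fieldType) (n : nat) (w : K) (w_prim : n.-primitive_root w).
Local Notation H := (taft w_prim).
Local Notation x := (taft_x w_prim).
Local Notation g := (taft_g w_prim).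
Local Notation mon := (taft_mon w_prim).
Implicit Types (u v : H) (N : {vspace H}).

Let n_gt0 : (0 < n)%N := prim_order_gt0 w_prim.
Let o0 : 'I_n := Ordinal n_gt0.

(** Matrix entries as scalar forms, so that they can be used as the
    functionals along which tensors are sliced. *)
Definition taft_coef (a b : 'I_n) u : K := u a b.

Lemma taft_coef_is_scalar a b : scalar (taft_coef a b).
Proof. by move=> c u v; rewrite /taft_coef !mxE. Qed.

HB.instance Definition _ a b :=
  GRing.isLinear.Build K H K _ (taft_coef a b) (taft_coef_is_scalar a b).

Lemma taft_coef_mon (a b : 'I_n) i j :
  taft_coef a b (mon i j) = ((a == i :> nat) && (b == j %[mod n]))%:R.
Proof. exact: mxE. Qed.

Lemma taft_monM i j k l : mon i j * mon k l = w ^+ (j * k) *: mon (i + k) (j + l).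
Proof. exact: taft_mul_mon. Qed.

Lemma taft_gX k : g ^+ k = mon 0 k.
Proof. by rewrite taft_monE mul1r. Qed.

Lemma taft_xX k : x ^+ k = mon k 0.
Proof. by rewrite taft_monE mulr1. Qed.

Lemma taft_comul_monE i j :
  taft_comul (mon i j) =
    \sum_(k < i.+1) qbin w i k *: tens (mon k (i - k + j)) (mon (i - k) j).
Proof.
rewrite taft_comul_mon (qexprD (q := w)); last first.
  by rewrite !tens_mul taft_gx tensZl mulr1 mul1r.
rewrite mulr_suml; apply: eq_bigr => k _; rewrite -scalerAl !tensX !tens_mul.
by rewrite expr1n mul1r -mulrA -exprD -!taft_monE.
Qed.

(** The comultiplication of x^i g^j has a single term, the one with first
    factor x^a g^(i - a + j), on which the (a, b) entry may be nonzero. *)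
Lemma slice_comul_mon (a b : 'I_n) i j :
  slice (taft_coef a b) (taft_comul (mon i j)) =
    (qbin w i a * (b == i - a + j %[mod n])%:R) *: mon (i - a) j.
Proof.
rewrite taft_comul_monE linear_sum /=.
have sl k : slice (taft_coef a b)
      (qbin w i k *: tens (mon k (i - k + j)) (mon (i - k) j)) =
    (qbin w i k * ((a == k :> nat) && (b == i - k + j %[mod n]))%:R) *:
      mon (i - k) j.
  by rewrite linearZ /= slice_tens scalerA /= taft_coef_mon.
have [le_ai|lt_ia] := leqP a i.
  rewrite (bigD1 (Ordinal (le_ai : (a < i.+1)%N))) //= sl eqxx.
  rewrite big1 ?addr0 // => k nk.
  rewrite sl; suff /negPf-> : (a : nat) != k by rewrite mulr0 scale0r.
  by rewrite eq_sym.
rewrite qbin_small // mul0r scale0r big1 // => k _.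
by rewrite sl gtn_eqF ?(leq_trans (ltn_ord k)) // mulr0 scale0r.
Qed.

Lemma qbinnn k : qbin w k k = 1.
Proof. by elim: k => // k IHk; rewrite qbinS IHk qbin_small // mulr0 addr0. Qed.

Lemma qbin_pred_neq0 k : (k.+1 < n)%N -> qbin w k.+1 k != 0.
Proof.
move=> lt_kn; apply/eqP=> q0; have := qbin_succ w k.+1 k.
rewrite q0 mulr0 qbinnn mulr1 => /eqP.
by rewrite subr_eq0 eq_sym -(prim_order_dvd w_prim) gtnNdvd.
Qed.

Lemma slice_comul (a b : 'I_n) u :
  slice (taft_coef a b) (taft_comul u) =
    \sum_(i < n) \sum_(j < n)
      (u i j * (qbin w i a * (b == i - a + j %[mod n])%:R)) *: mon (i - a) j.
Proof.
rewrite /taft_comul linear_sum; apply: eq_bigr => i _.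
rewrite linear_sum; apply: eq_bigr => j _.
by rewrite linearZ /= -taft_comul_mon slice_comul_mon scalerA.
Qed.

Lemma sum_coset_mon (F : 'I_n -> K) (b : 'I_n) (c d k : nat) :
    (c == d + b %[mod n]) ->
  \sum_(j < n) (F j * (c == d + j %[mod n])%:R) *: mon k j = F b *: mon k b.
Proof.
move=> cb; rewrite (bigD1 b) //= cb mulr1 big1 ?addr0 // => j nj.
rewrite (eqP cb) eqn_modDl !modn_small //.
suff /negPf-> : (b : nat) != j by rewrite mulr0 scale0r.
by rewrite eq_sym.
Qed.

(** * Elements of a coideal of maximal degree in x *)

Section TopDegree.

Variables (N : {vspace H}) (u : H) (a : 'I_n).
Hypotheses (coN : left_coideal_subalgebra N) (Nu : u \in N).
Hypothesis top_a : forall i j : 'I_n, (a < i)%N -> u i j = 0.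

Let slice_in (a1 b : 'I_n) : slice (taft_coef a1 b) (taft_comul u) \in N.
Proof. by have [_ /(_ u Nu)/mem_tensor_vsP] := coN. Qed.

(** Slicing at (a, b) kills the degrees in x below a, where the q-binomial
    vanishes, and above a, where u does; in degree a exactly one grouplike
    survives. *)
Lemma top_coef_grouplike (b : 'I_n) : u a b *: g ^+ b \in N.
Proof.
have := slice_in a b; rewrite slice_comul (bigD1 a) //=.
rewrite [X in _ + X]big1 => [|i ni].
  rewrite addr0 qbinnn subnn; under eq_bigr do rewrite mul1r.
  by rewrite (@sum_coset_mon _ b) // -taft_gX.
rewrite big1 // => j _; have [lt_ai|] := ltnP a i.
  by rewrite top_a // mul0r scale0r.
rewrite leq_eqVlt (negPf ni : (i == a :> nat) = false) /= => lt_ia.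
by rewrite qbin_small // mul0r mulr0 scale0r.
Qed.

(** Slicing one degree below the top leaves a combination of x g^b and
    g^(b+1).  The coefficient of x g^b is u a b times the q-integer [a], which
    is nonzero as a < n.  Since g^b is in N as well, so is its inverse, by
    which one can multiply. *)
Lemma top_coef_skew_primitive (b : 'I_n) : (0 < a)%N -> u a b != 0 ->
  exists c, x + c *: g \in N.
Proof.
move=> a0 uab; have [[N1 NN] _] := coN.
have NM v1 v2 : v1 \in N -> v2 \in N -> v1 * v2 \in N.
  by move=> N1' N2'; apply/(subvP NN)/memv_mul.
have gb : g ^+ b \in N.
  by rewrite -[g ^+ b]scale1r -(mulVf uab) -scalerA memvZ // top_coef_grouplike.
have lt_a1n : (a.-1 < n)%N by rewrite (leq_ltn_trans (leq_pred a)).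
pose a1 := Ordinal lt_a1n; pose b1 := Ordinal (ltn_pmod b.+1 n_gt0).
have aE : (a - a1 = 1)%N by rewrite /= -{1}(prednK a0) subSnn.
have neq_a1 : a1 != a by rewrite -val_eqE /= ltn_eqF // prednK.
(* Only the rows a and a - 1 of u contribute: the lower ones are killed by the
   q-binomial, the higher ones are zero. *)
have := slice_in a1 b1; rewrite slice_comul.
rewrite (bigD1 a) //= [X in _ + X](bigD1 a1) //=.
rewrite aE subnn [X in _ + (_ + X)]big1 => [|i /andP[nia nia1]]; last first.
  rewrite big1 // => j _; have [lt_ai|le_ia] := ltnP a i.
    by rewrite top_a // mul0r scale0r.
  rewrite qbin_small ?mul0r ?mulr0 ?scale0r // ltn_neqAle nia1 /=.
  by rewrite -ltnS prednK // ltn_neqAle nia.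
under eq_bigr do rewrite mulrA.
rewrite addr0 (@sum_coset_mon (fun j => u a j * _) b) ?modn_mod //.
rewrite qbinnn; under [X in _ + X]eq_bigr do rewrite mul1r.
rewrite (@sum_coset_mon _ b1) ?modn_mod // => Ny.
(* The inverse of g^b is (g^b)^(n - 1). *)
have gbX k : (g ^+ b) ^+ k \in N.
  by elim: k => [|k IHk]; rewrite ?expr0 // exprS NM.
have := NM _ _ Ny (gbX n.-1); rewrite -exprM taft_gX mulrDl -!scalerAl.
rewrite !taft_monM ?mul0n ?muln0 ?expr0 !scale1r !addn0.
have -> : mon 1 (b + b * n.-1) = x.
  by rewrite -mulnS prednK // -taft_mon_mod modnMl.
have -> : mon 0 (b1 + b * n.-1) = g.
  rewrite -taft_mon_mod /= modnDml addSn -mulnS prednK // -addn1 modnMDl.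
  by rewrite taft_mon_mod.
have p0 : u a b * qbin w a a1 != 0.
  rewrite mulf_neq0 //; have := @qbin_pred_neq0 a.-1.
  by rewrite prednK //; apply.
move=> Nxg; exists ((u a b * qbin w a a1)^-1 * u a1 b1).
rewrite -scalerA -[x]scale1r -(mulVf p0) -[X in X + _]scalerA -scalerDr.
exact: memvZ.
Qed.

End TopDegree.

(** * The nilpotent ideal generated by x *)

Lemma taft_comm_xX k u : exists v, u * x ^+ k = x ^+ k * v.
Proof.
elim/taft_ind: u => [u1 u2 [v1 h1] [v2 h2]|c i j].
  by exists (v1 + v2); rewrite mulrDl mulrDr h1 h2.
exists (w ^+ (j * k) *: (c *: mon i j)).
rewrite taft_xX -scalerAl -!scalerAr !taft_monM mul0n scale1r addn0 addnC.
by rewrite !scalerA mulrC.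
Qed.

(** The right ideal x^k H, which is two-sided by taft_comm_xX. *)
Definition xideal k : {vspace H} := limg (amull (x ^+ k)).

Lemma xidealP k u : reflect (exists v, u = x ^+ k * v) (u \in xideal k).
Proof.
apply: (iffP memv_imgP) => [[v _ ->] | [v ->]]; first by exists v; rewrite lfunE.
by exists v; rewrite ?memvf // lfunE.
Qed.

Lemma xidealM k l : (xideal k * xideal l <= xideal (k + l))%VS.
Proof.
apply/prodvP=> _ _ /xidealP[u ->] /xidealP[v ->]; apply/xidealP.
have [u' uE] := taft_comm_xX l u.
by exists (u' * v); rewrite exprD -!mulrA; congr (_ * _); rewrite !mulrA uE.
Qed.

Lemma xideal0 : xideal 0 = fullv.
Proof.
apply/eqP; rewrite eqEsubv subvf; apply/subvP=> u _; apply/xidealP.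
by exists u; rewrite mul1r.
Qed.

Lemma xideal_nilpotent (I J : {vspace H}) :
  (J <= xideal 1)%VS -> (I <= J * I)%VS -> I = 0%VS.
Proof.
move=> sJ sI; have sIk k : (I <= xideal k)%VS.
  elim: k => [|k IHk]; first by rewrite xideal0 subvf.
  by apply: subv_trans sI (subv_trans (prodvS sJ IHk) _); rewrite xidealM.
apply/eqP; rewrite -subv0; apply/subvP=> u /(subvP (sIk n))/xidealP[v ->].
by rewrite taft_xXn mul0r mem0v.
Qed.

Lemma mem_xideal1 u : (forall b, u o0 b = 0) -> u \in xideal 1.
Proof.
move=> u0; rewrite [u]taft_expand memv_suml // => i _; rewrite memv_suml // => j _.
case: i => [[|i] lt_in] /=.
  by rewrite (_ : Ordinal _ = o0) ?u0 ?scale0r ?mem0v //; apply: val_inj.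
rewrite memvZ //; apply/xidealP; exists (mon i j).
by rewrite expr1 taft_monM scale1r.
Qed.

(** The intersection is a nilpotent ideal of N.  Hence N embeds in
    H / xH = K[g]. *)
Lemma semisimple_cap_xideal N :
  unital_subalgebra N -> semisimple_subalgebra N -> (N :&: xideal 1 = 0)%VS.
Proof.
move=> uN ssN; have [_ NN] := uN.
apply: (semisimple_no_nilpotent_ideal uN ssN).
- rewrite subv_cap (subv_trans _ NN) ?prodvSr ?capvSl //=.
  by apply: subv_trans (xidealM 0 1); rewrite prodvS ?capvSr // xideal0 subvf.
- exact: capvSl.
- by move=> I; apply: xideal_nilpotent; apply: capvSr.
Qed.

(** * The subalgebras generated by one element *)

Lemma beta_gen_exp beta k :
  (g + beta *: x) ^+ k =
    \sum_(i < k.+1) (qbin w k i * beta ^+ i) *: mon i (k - i).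
Proof.
rewrite addrC (qexprD (q := w)); last first.
  by rewrite -scalerAl -scalerAr taft_gx !scalerA mulrC.
apply: eq_bigr => i _; rewrite exprZn -scalerAl scalerA taft_gX taft_xX.
by rewrite taft_monM mul0n scale1r addn0.
Qed.

(** In the q-binomial expansion the middle terms vanish, because the
    q-binomials of n at a primitive n-th root of unity do, and x^n = 0. *)
Lemma beta_gen_order beta : (g + beta *: x) ^+ n = 1.
Proof.
rewrite beta_gen_exp big_ord_recl /= qbin0 !mul1r subn0 -taft_gX taft_gXn.
rewrite scale1r big1 ?addr0 // => i _; rewrite /bump add1n.
have [lt_in|le_ni] := ltnP i.+1 n.
  by rewrite (qbin_prim w_prim) ?mul0r ?scale0r.
by rewrite taft_mon_eq0 ?scaler0.
Qed.

(** Modulo xH the element g + beta x becomes g. *)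
Lemma beta_gen_exp_coef0 beta k (b : 'I_n) :
  ((g + beta *: x) ^+ k) o0 b = (b == k %[mod n])%:R.
Proof.
rewrite beta_gen_exp big_ord_recl mxE summxE big1 => [|i _]; last first.
  by rewrite !mxE lift0 mulr0.
by rewrite !mxE /= qbin0 subn0 !mul1r addr0.
Qed.

(** The comultiplication is multiplicative and H (x) N is a subalgebra when N
    is, so that the condition on the generator suffices. *)
Lemma left_coideal_adjoin1 t :
    taft_comul t \in tensor_vs {:H} <<1; t>>%VS ->
  left_coideal_subalgebra <<1; t>>%VS.
Proof.
set N := <<1; t>>%VS => Nt.
have N1 : 1 \in N by rewrite memvE sub1_agenv.
have NN : (N * N <= N)%VS by rewrite agenvM.
split=> // u Nu.
have /subvP/(_ u Nu) :
    (N <= linfun (@taft_comul K n w w_prim) @^-1: tensor_vs {:H} N)%VS.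
  apply: agenv_sub_modl.
    rewrite -memvE -memv_preim lfunE /= rmorph1; exact: tens_mem.
  rewrite prodvDl prod1v subv_add subvv; apply/prodvP=> v1 v2 /vlineP[c ->].
  rewrite -!memv_preim !lfunE /= => Nv2.
  by rewrite rmorphM /= linearZ -scalerAl memvZ // tensor_vsM.
by rewrite -memv_preim lfunE.
Qed.

End TaftCoideals.

Section Classification.
Set Implicit Arguments.
Unset Strict Implicit.

Variables (K : fieldType) (n : nat) (w : K) (w_prim : n.-primitive_root w).
Hypothesis n_gt1 : (1 < n)%N.
Local Notation H := (taft w_prim).
Local Notation x := (taft_x w_prim).
Local Notation g := (taft_g w_prim).
Local Notation mon := (taft_mon w_prim).
Implicit Types (u v : H) (N : {vspace H}).

Let n_gt0 : (0 < n)%N := prim_order_gt0 w_prim.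
Let o0 : 'I_n := Ordinal n_gt0.

Lemma taft_gX_coef0 k (b : 'I_n) : (g ^+ k : H) o0 b = (b == k %[mod n])%:R.
Proof. by rewrite taft_gX !mxE. Qed.

Lemma taft_gX_mod k : g ^+ (k %% n) = g ^+ k.
Proof. exact: expr_mod (taft_gXn w_prim). Qed.

(** The entries of row 0 see elements modulo xH; the powers of t are
    independent as soon as they are in this quotient. *)
Lemma semisimple_of_coef0 m (z : K) (t : H) :
    m.-primitive_root z -> t ^+ m = 1 ->
    (forall j : 'I_m, exists b, forall i : 'I_m, (t ^+ i) o0 b = (i == j)%:R) ->
  semisimple_subalgebra <<1; t>>%VS.
Proof.
move=> z_prim tm dual; apply: (semisimple_cyclic z_prim tm) => c c0 j.
have [b tb] := dual j; move/matrixP/(_ o0 b): c0; rewrite summxE mxE => <-.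
rewrite (bigD1 j) //= mxE tb eqxx mulr1 big1 ?addr0 // => i nij.
by rewrite mxE tb (negPf nij) mulr0.
Qed.

Lemma semisimple_beta beta : semisimple_subalgebra (beta_subalgebra w_prim beta).
Proof.
apply: (semisimple_of_coef0 w_prim (beta_gen_order w_prim beta)) => j.
exists j => i; rewrite beta_gen_exp_coef0 !modn_small //.
by rewrite eq_sym.
Qed.

(** The comultiplication of g + beta x is g (x) (g + beta x) + beta x (x) 1. *)
Lemma left_coideal_beta beta :
  left_coideal_subalgebra (beta_subalgebra w_prim beta).
Proof.
apply: left_coideal_adjoin1; rewrite linearD linearZ /= taft_comul_g taft_comul_x.
rewrite scalerDr addrCA -!tensZr -tensDr memvD ?tens_mem ?memv_adjoin //.
by rewrite memvZ // memvE sub1_agenv.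
Qed.

Lemma val_Zp_expg (a : 'Z_n) k : (a ^+ k)%g = (a * k %% n)%N :> nat.
Proof. by rewrite Zp_expg /= {2}Zp_cast. Qed.

Lemma subgroup_Zn_cyclic (G : {group 'Z_n}) :
  exists a : 'Z_n, G :=: <[a]>%g.
Proof.
apply/cyclicP/(cyclicS (subsetT G))/cyclicP; exists Zp1; exact: Zp_cycle.
Qed.

Lemma taft_gX_expg (a : 'Z_n) k : g ^+ (a ^+ k)%g = (g ^+ a) ^+ k.
Proof. by rewrite val_Zp_expg taft_gX_mod exprM. Qed.

Lemma taft_gX_order (a : 'Z_n) : (g ^+ a) ^+ #[a]%g = 1.
Proof. by rewrite -taft_gX_expg expg_order. Qed.

Lemma group_subalgebra_adjoin1 (G : {group 'Z_n}) (a : 'Z_n) :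
  G :=: <[a]>%g -> group_subalgebra w_prim G = <<1; (g ^+ a)%R>>%VS.
Proof.
move=> defG; rewrite (adjoin1_cyclic (order_gt0 a) (taft_gX_order a)).
apply/eqP; rewrite eqEsubv; apply/andP; split.
  apply/span_subvP=> _ /mapP[j + ->]; rewrite mem_enum defG.
  case/cyclePmin=> k lt_k ->; rewrite taft_gX_expg memvE.
  exact: (sumv_sup (Ordinal lt_k)).
apply/subv_sumP=> j _; rewrite -memvE memv_span //; apply/mapP.
by exists (a ^+ j)%g; rewrite ?taft_gX_expg // mem_enum defG mem_cycle.
Qed.

Lemma semisimple_group (G : {group 'Z_n}) :
  semisimple_subalgebra (group_subalgebra w_prim G).
Proof.
have [a defG] := subgroup_Zn_cyclic G; rewrite (group_subalgebra_adjoin1 defG).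
have dvd_an : (#[a]%g %| n)%N.
  by have := order_dvdG (in_setT a); rewrite cardsT card_ord (Zp_cast n_gt1).
apply: (semisimple_of_coef0 (dvdn_prim_root w_prim dvd_an) (taft_gX_order a)) => j.
exists (cast_ord (Zp_cast n_gt1) (a ^+ j)%g) => i.
rewrite -taft_gX_expg taft_gX_coef0 /=.
have lt_n (c : 'Z_n) : (c < n)%N by rewrite -[X in (_ < X)%N](Zp_cast n_gt1).
rewrite !modn_small // [in LHS]val_eqE eq_expg_mod_order !modn_small //.
by rewrite eq_sym.
Qed.

Lemma left_coideal_group (G : {group 'Z_n}) :
  left_coideal_subalgebra (group_subalgebra w_prim G).
Proof.
have [a defG] := subgroup_Zn_cyclic G; rewrite (group_subalgebra_adjoin1 defG).
apply: left_coideal_adjoin1; rewrite rmorphXn /= taft_comul_g tensX.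
by rewrite tens_mem ?memv_adjoin.
Qed.

(** * The two types of semisimple coideal subalgebras *)

(** Every element of N is then in top degree 0, so that N is spanned by the
    grouplikes that it contains; these form a group. *)
Lemma coideal_subalgebra_in_kG N :
    left_coideal_subalgebra N ->
    (forall u (i j : 'I_n), u \in N -> (0 < i)%N -> u i j = 0) ->
  exists G : {group 'Z_n}, N = group_subalgebra w_prim G.
Proof.
move=> coN N0; have [[N1 NN] _] := coN.
(* In a finite group, closure under products suffices. *)
pose G := [set j : 'Z_n | g ^+ j \in N].
have gG : group_set G.
  apply/group_setP; split=> [|i j]; rewrite !inE // => Ni Nj.
  rewrite /= {3}Zp_cast // taft_gX_mod exprD; exact/(subvP NN)/memv_mul.
exists (Group gG); apply/eqP; rewrite eqEsubv; apply/andP; split; last first.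
  by apply/span_subvP=> _ /mapP[j + ->]; rewrite mem_enum inE.
apply/subvP=> u Nu; rewrite [u]taft_expand (bigD1 o0) //=.
rewrite [X in _ + X]big1 => [|i ni].
  rewrite addr0 memv_suml // => b _; rewrite -taft_gX.
  have Ngb := @top_coef_grouplike _ _ _ _ N u o0 coN Nu (fun i j => N0 u i j Nu) b.
  have [->|ub] := eqVneq (u o0 b) 0; first by rewrite scale0r mem0v.
  rewrite memvZ // memv_span //; apply/mapP.
  exists (cast_ord (esym (Zp_cast n_gt1)) b) => //.
  rewrite mem_enum inE /= -[g ^+ b]scale1r -(mulVf ub) -scalerA.
  exact: memvZ.
rewrite big1 // => j _; rewrite N0 ?scale0r // lt0n.
exact: ni.
Qed.

(** Otherwise x would lie in the intersection of N and xH, which is 0. *)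
Lemma mem_x_not_semisimple N :
  unital_subalgebra N -> x \in N -> ~ semisimple_subalgebra N.
Proof.
move=> uN Nx /(semisimple_cap_xideal uN)/eqP; rewrite -subv0 => /subvP/(_ x).
rewrite memv_cap Nx memv0 => /(_ _)/eqP.
have -> : x \in xideal w_prim 1 by apply/xidealP; exists 1; rewrite mulr1.
move=> /(_ isT)/matrixP/(_ (Ordinal n_gt1) o0)/eqP.
by rewrite !mxE !eqxx oner_eq0.
Qed.

(** N contains the powers of t = g + beta x, which already span H modulo xH,
    and N meets xH only in 0. *)
Lemma semisimple_with_beta_gen N beta :
    unital_subalgebra N -> semisimple_subalgebra N -> g + beta *: x \in N ->
  N = beta_subalgebra w_prim beta.
Proof.
set t := g + _ => uN ssN Nt; have [N1 NN] := uN.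
have NX k : t ^+ k \in N.
  by elim: k => // k IHk; rewrite exprS; apply/(subvP NN)/memv_mul.
apply/eqP; rewrite eqEsubv; apply/andP; split; last first.
  apply: agenv_sub_modl; first by rewrite -memvE.
  rewrite prodvDl prod1v subv_add subvv; apply: subv_trans NN.
  by rewrite prodvSl // -memvE.
(* The combination of powers of t congruent to u modulo xH. *)
apply/subvP=> u Nu; pose s := \sum_(b < n) u o0 b *: t ^+ b.
suff : u - s == 0.
  rewrite subr_eq0 => /eqP->.
  rewrite memv_suml // => b _; rewrite memvZ //.
  elim: (b : nat) => [|k IHk]; first by rewrite memvE sub1_agenv.
  by rewrite exprS /beta_subalgebra -agenvM memv_mul // memv_adjoin.
rewrite -memv0 -(semisimple_cap_xideal uN ssN) memv_cap memvB //=; last first.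
  by rewrite memv_suml // => b _; rewrite memvZ.
apply: mem_xideal1 => b; rewrite !mxE summxE (bigD1 b) //= mxE.
rewrite beta_gen_exp_coef0 eqxx mulr1 big1 ?addr0 ?subrr // => c ncb.
rewrite mxE beta_gen_exp_coef0 !modn_small //.
suff /negPf-> : (b : nat) != c by rewrite mulr0.
by rewrite eq_sym.
Qed.

Lemma top_degree u (i j : 'I_n) : (0 < i)%N -> u i j != 0 ->
  exists a b : 'I_n, [/\ (0 < a)%N, u a b != 0 &
    forall k l : 'I_n, (a < k)%N -> u k l = 0].
Proof.
move=> i0 uij; have Pi : [exists b, u i b != 0] by apply/existsP; exists j.
case: (@arg_maxnP _ i (fun a => [exists b, u a b != 0]) (@nat_of_ord n) Pi).
move=> a /existsP[b uab] max_a; exists a, b; split=> // [|k l lt_ak].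
  exact: leq_trans i0 (max_a _ Pi).
apply/eqP; apply: contraTT lt_ak => ukl; rewrite -leqNgt; apply: max_a.
by apply/existsP; exists l.
Qed.

End Classification.

Theorem proposition4p6 (K : fieldType) (n : nat) (n_ge2 : (2 <= n)%N) (w : K)
    (w_prim : n.-primitive_root w) (N : {vspace taft w_prim}) :
  (left_coideal_subalgebra N /\ semisimple_subalgebra N) <->
  ((exists G' : {group 'Z_n}, N = group_subalgebra w_prim G') \/
   (exists2 beta : K, beta != 0 & N = beta_subalgebra w_prim beta)).
Proof.
split=> [[coN ssN] | [[G ->] | [beta _ ->]]]; last 2 first.
- by split; [apply: left_coideal_group | apply: semisimple_group].
- by split; [apply: left_coideal_beta | apply: semisimple_beta].
have [uN _] := coN.
have [/existsP[k /existsP[i /existsP[j /andP[i0 kij]]]]|xfree] :=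
  boolP [exists k : 'I_(\dim N), exists i : 'I_n, exists j : 'I_n,
    (0 < i)%N && (((vbasis N)`_k : taft w_prim) i j != 0)].
  right; have Nk : (vbasis N)`_k \in N by rewrite vbasis_mem ?mem_nth ?size_tuple.
  have [a [b [a0 ab top]]] := top_degree i0 kij.
  have [c Nxc] := top_coef_skew_primitive coN Nk top a0 ab.
  (* For c = 0 the nilpotent x is in N; otherwise rescale x + c g. *)
  have [c0|c0] := eqVneq c 0.
    case: (mem_x_not_semisimple n_ge2 uN _ ssN).
    by move: Nxc; rewrite c0 scale0r addr0.
  exists c^-1; first by rewrite invr_eq0.
  apply: (semisimple_with_beta_gen uN ssN).
  rewrite -[taft_g _]scale1r -(mulVf c0) -scalerA -scalerDr addrC.
  exact: memvZ.
left; apply: (coideal_subalgebra_in_kG n_ge2 coN) => u i j Nu i0.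
rewrite (coord_vbasis Nu) summxE big1 // => k _; rewrite mxE.
move: xfree => /existsPn/(_ k)/existsPn/(_ i)/existsPn/(_ j).
by rewrite i0 negbK => /eqP->; rewrite mulr0.
Qed.
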